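(* For each positive integer $n$, $a(n)=1$ if $$n\in\bigcup_{m\ge3}\Big([2t_{m-1}..t_m+2t_{m-3}-1]\cup[2t_m-t_{m-1}..\tfrac{3t_m+t_{m-2}-3}{2}]\Big),$$ and $a(n)=0$ otherwise.
   Context: The Tribonacci substitution $\sigma$ on the alphabet $\{a,b,c\}$ is $\sigma(a)=ab$, $\sigma(b)=ac$, $\sigma(c)=a$. The Tribonacci sequence $\mathbb{T}$ is the infinite word that is the fixed point of $\sigma$ beginning with $a$; $\mathbb{T}[1,n]$ is its prefix of length $n$ ($\mathbb{T}[1,0]$ is empty). Put $T_{-2}=\epsilon$ (empty word), $T_{-1}=c$, $T_m=\sigma^m(a)$ for $m\ge0$, $t_m=|T_m|$ for $m\ge-2$, and $t_{-3}=0$; thus $t_{-3}=t_{-2}=0$, $t_{-1}=t_0=1$, $t_1=2$, $t_2=4$, $t_3=7$, $t_4=13$, and $t_m=t_{m-1}+t_{m-2}+t_{m-3}$ for $m\ge1$. $[x..y]$ denotes the set of integers $\{x,x+1,\ldots,y\}$. Write $u\prec v$ if $u$ is a factor (contiguous subword) of $v$. Let $A(n)=\#\{\omega\mid\omega\text{ non-empty word},\ \omega\omega\prec\mathbb{T}[1,n]\}$ for $n\ge0$ (number of distinct squares in $\mathbb{T}[1,n]$) and $a(n)=A(n)-A(n-1)$ for $n\ge1$. *)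

(* Defs.v *)
From HB Require Import structures.
From mathcomp Require Import all_boot all_order all_algebra.

Set Implicit Arguments.
Unset Strict Implicit.
Unset Printing Implicit Defensive.

Inductive letter : Set := La | Lb | Lc.

Definition ord_of_letter (x : letter) : 'I_3 :=
  match x with
  | La => @Ordinal 3 0 isT | Lb => @Ordinal 3 1 isT | Lc => @Ordinal 3 2 isT
  end.

Definition letter_of_ord (i : 'I_3) : letter :=
  match val i with 0 => La | 1 => Lb | _ => Lc end.

Lemma ord_of_letterK : cancel ord_of_letter letter_of_ord.
Proof. by case. Qed.

HB.instance Definition _ := Finite.copy letter (can_type ord_of_letterK).

Definition sigma_letter (x : letter) : seq letter :=
  match x with La => [:: La; Lb] | Lb => [:: La; Lc] | Lc => [:: La] end.

Definition sigma (u : seq letter) : seq letter :=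
  flatten [seq sigma_letter x | x <- u].

Definition T (m : nat) : seq letter := iter m sigma [:: La].

Definition t (m : nat) : nat := size (T m).

(* [w] is the infinite word w 0, w 1, ...  It is fixed by sigma when the image
   of each of its prefixes is again one of its prefixes; the images have
   unbounded length, so together they make up the whole of sigma(w). *)
Definition fixed_point (w : nat -> letter) : Prop :=
  forall n, sigma (mkseq w n) = mkseq w (size (sigma (mkseq w n))).

(* The fixed point of sigma beginning with La, indexed from 0: T n is a
   prefix of it, of length greater than n (see [tribonacciP]). *)
Definition tribonacci (n : nat) : letter := nth La (T n) n.

(* The prefix of length n, written T[1,n] when positions are counted from 1. *)
Definition trib_prefix (n : nat) : seq letter := mkseq tribonacci n.

(* [n.-bseq letter] is the finite type of words of length at most n; by
   [size_square_root] no square root is lost. *)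
Definition A (n : nat) : nat :=
  #|[set w : n.-bseq letter |
      ((w : seq letter) != [::]) && infix (w ++ w) (trib_prefix n)]|.

Definition a (n : nat) : int := ((A n)%:Z - (A n.-1)%:Z)%R.

Lemma size_square_root n (w : seq letter) :
  infix (w ++ w) (trib_prefix n) -> size w <= n.
Proof.
move=> /size_infix; rewrite size_cat size_mkseq; exact: leq_trans (leq_addr _ _).
Qed.

Lemma sigma_cat u v : sigma (u ++ v) = sigma u ++ sigma v.
Proof. by rewrite /sigma map_cat flatten_cat. Qed.

Lemma T_rec m : T m.+3 = T m.+2 ++ T m.+1 ++ T m.
Proof.
elim: m => // m IHm.
rewrite [LHS](_ : _ = sigma (T m.+3)) //.
by rewrite {1}IHm !sigma_cat.
Qed.

Lemma t_rec m : t m.+3 = t m.+2 + t m.+1 + t m.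
Proof. by rewrite /t T_rec !size_cat addnA. Qed.

Lemma T_prefix1 m : prefix (T m) (T m.+1).
Proof. by case: m => [|[|m]] //; rewrite T_rec prefix_prefix. Qed.

Lemma T_prefix m n : m <= n -> prefix (T m) (T n).
Proof.
move=> /subnK <-; elim: (n - m) => [|k IHk]; first exact: prefix_refl.
exact: prefix_trans IHk (T_prefix1 _).
Qed.

Lemma t_gt m : m < t m.
Proof.
suff: (m < t m) && ((m.+1 < t m.+1) && (m.+2 < t m.+2)) by case/andP.
elim: m => // m /and3P[h0 h1 h2]; apply/and3P; split=> //.
rewrite t_rec -addnA (leq_ltn_trans h2) // -[ltnLHS]addn0 ltn_add2l.
by rewrite addn_gt0 (leq_ltn_trans _ h1).
Qed.

Lemma nth_T m i : i < t m -> nth La (T m) i = tribonacci i.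
Proof.
move=> lim; rewrite /tribonacci; case: (leqP m i) => [|/ltnW] /T_prefix /prefixP[s ->].
  by rewrite nth_cat lim.
by rewrite nth_cat t_gt.
Qed.

Lemma T_trib m : T m = trib_prefix (t m).
Proof.
apply: (@eq_from_nth _ La); rewrite /trib_prefix ?size_mkseq // => i lti.
by rewrite nth_T // nth_mkseq.
Qed.

Lemma take_mkseq (w : nat -> letter) k n :
  k <= n -> take k (mkseq w n) = mkseq w k.
Proof. by move=> lkn; rewrite /mkseq -map_take take_iota (minn_idPl lkn). Qed.

Lemma prefix_mkseq (w : nat -> letter) u n :
  prefix u (mkseq w n) -> u = mkseq w (size u).
Proof.
move=> pu; have := size_prefix pu; rewrite size_mkseq => lun.
move: pu; rewrite prefixE => /eqP {1}<-.
by rewrite take_mkseq.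
Qed.

Lemma sigma_prefix u v : prefix u v -> prefix (sigma u) (sigma v).
Proof. by move=> /prefixP[s ->]; rewrite sigma_cat prefix_prefix. Qed.

Theorem tribonacciP (w : nat -> letter) :
  (w 0 = La /\ fixed_point w) <-> w =1 tribonacci.
Proof.
split=> [[w0 fw] n|ew].
  suff ET m : T m = mkseq w (t m) by rewrite /tribonacci ET nth_mkseq ?t_gt.
  elim: m => [|m IHm]; first by rewrite /= /mkseq /= w0.
  have -> : T m.+1 = sigma (mkseq w (t m)) by rewrite -IHm.
  by rewrite {1}fw; congr mkseq; rewrite -IHm.
have Em n : mkseq w n = trib_prefix n by apply: eq_map.
split=> [|n]; first by rewrite ew.
rewrite !Em; apply: (@prefix_mkseq _ _ (t n.+1)).
rewrite -/(trib_prefix _) -T_trib; apply: (@sigma_prefix _ (T n)).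
rewrite T_trib prefixE /trib_prefix size_mkseq take_mkseq //; exact: ltnW (t_gt n).
Qed.

(* So 3 * t m.+2 + t m - 3 is even, and halving it is exact. *)
Lemma odd_t_add m : odd (t m.+2 + t m).
Proof.
elim: m => // m; rewrite t_rec !oddD.
by case: (odd (t m.+2)); case: (odd (t m.+1)); case: (odd (t m)).
Qed.

(* Main.v *)
(* Cutting the Tribonacci word before each occurrence of a desubstitutes any
   repetition into one with a shorter period.  Hence every square lies in a run
   obtained by applying sigma repeatedly to one letter x and adding one letter
   on the right at each step: its period is |sigma^k(x)|, and it exceeds that
   period by d_k = t_0 + ... + t_(k-1) letters.  Runs of the same level over
   the same letter carry the same word, so each square first appears in the
   run over the first a, b or c (positions 0, 1, 3).  The words sigma^k(x) are
   primitive, hence distinct shifts in a run give distinct squares; the only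
   other coincidences come from sigma(c) = a, between level k+1 over c and
   level k over a. *)

Require Import Defs.
From mathcomp Require Import all_boot all_order all_algebra.
From mathcomp Require Import zify.

Set Implicit Arguments.
Unset Strict Implicit.
Unset Printing Implicit Defensive.

Local Notation w := tribonacci.

(** * Block structure of the sequence under sigma *)

(** As sigma fixes the sequence, this is the position where the block [sigma_letter (w n)]
    starts. *)
Definition sigma_len (n : nat) : nat := size (sigma (trib_prefix n)).
Local Notation f := sigma_len.

(* The letter that follows the initial La of the block [sigma_letter x], inside
   the block or, when x is Lc, at the start of the next one. *)
Definition next_letter (x : letter) : letter :=
  match x with La => Lb | Lb => Lc | Lc => La end.

Lemma next_letter_inj : injective next_letter.
Proof. by case; case. Qed.

Lemma sigma_len0 : f 0 = 0.
Proof. by []. Qed.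

Lemma trib_prefixS n : trib_prefix n.+1 = trib_prefix n ++ [:: w n].
Proof. by rewrite /trib_prefix mkseqS cats1. Qed.

Lemma sigma_trib_prefix n : sigma (trib_prefix n) = trib_prefix (f n).
Proof. by have [_ /(_ (fun _ => erefl))[_]] := tribonacciP w; apply. Qed.

Lemma sigma_lenS n : f n.+1 = (f n).+1 + (w n != Lc).
Proof.
rewrite /sigma_len trib_prefixS sigma_cat size_cat addSnnS.
by congr addn; case: (w n).
Qed.

Lemma trib_sigma n k : k < size (sigma_letter (w n)) ->
  w (f n + k) = nth La (sigma_letter (w n)) k.
Proof.
move=> ltk; have := sigma_trib_prefix n.+1.
rewrite {1}trib_prefixS sigma_cat sigma_trib_prefix /sigma /= cats0.
move=> /(congr1 (fun s => nth La s (f n + k))).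
rewrite nth_cat size_mkseq ltnNge leq_addr /= addKn => ->.
rewrite nth_mkseq //.
move: ltk; rewrite sigma_lenS; case: (w n) => /=; lia.
Qed.

Lemma trib_sigma_len n : w (f n) = La.
Proof. by rewrite -[f n]addn0 trib_sigma; case: (w n). Qed.

Lemma trib_sigma_lenS n : w (f n).+1 = next_letter (w n).
Proof.
rewrite -addn1; case E: (w n == Lc).
  by rewrite addn1 -[_.+1]addn0 -[0]/(nat_of_bool (~~ true)) -E -sigma_lenS
             trib_sigma_len (eqP E).
by rewrite trib_sigma; case: (w n) E.
Qed.

Lemma ltn_sigma_len m n : m < n -> f m < f n.
Proof.
elim: n => // n IHn.
by rewrite ltnS leq_eqVlt sigma_lenS => /predU1P[->|/IHn]; lia.
Qed.

Lemma leq_sigma_len m n : m <= n -> f m <= f n.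
Proof. by rewrite leq_eqVlt => /predU1P[->|/ltn_sigma_len/ltnW]. Qed.

Lemma leq_sigma_len_add x n : f x + n <= f (x + n).
Proof. by elim: n => [|n IHn]; rewrite ?addn0 // !addnS sigma_lenS; lia. Qed.

Lemma sigma_len_block k :
  exists K, k = f K \/ k = (f K).+1 /\ w K != Lc.
Proof.
elim: k => [|k [K [->|[-> nc]]]]; first by exists 0; left.
- case nc: (w K != Lc); first by exists K; right.
  by exists K.+1; left; rewrite sigma_lenS nc addn0.
- by exists K.+1; left; rewrite sigma_lenS nc addn1.
Qed.

Lemma trib_La k : w k = La -> exists K, k = f K.
Proof.
have [K [->|[-> nc]]] := sigma_len_block k; first by exists K.
by rewrite trib_sigma_lenS; case: (w K) nc.
Qed.

Lemma trib_notLa k : w k <> La -> exists K, k = (f K).+1 /\ w K != Lc.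
Proof.
have [K [->|? _]] := sigma_len_block k; last by exists K.
by rewrite trib_sigma_len.
Qed.

Lemma trib_notLaS k : w k <> La -> w k.+1 = La.
Proof.
move=> /trib_notLa[K [-> nc]].
by rewrite (_ : _.+2 = f K.+1) ?trib_sigma_len // sigma_lenS nc addn1.
Qed.

(** If q consecutive blocks have total length q, each is the image of c; since c is always followed
    by a, q = 1. *)
Lemma sigma_len_period x q :
  0 < q -> f (x + q) = f x + q -> q = 1 /\ w x = Lc.
Proof.
case: q => [|[|q]] // _.
  by rewrite !addn1 sigma_lenS; case: (w x =P Lc) => //= _; lia.
have -> : x + q.+2 = x.+2 + q by lia.
have := leq_sigma_len_add x.+2 q; rewrite !sigma_lenS.
case: (w x =P Lc) => [xc|_]; last by rewrite /=; lia.
by rewrite trib_notLaS ?xc //=; lia.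
Qed.

(** * Agreement of factors and desubstitution *)

Definition agree (x y n : nat) : Prop :=
  forall i, i < n -> w (x + i) = w (y + i).

Lemma agree_sym x y n : agree x y n -> agree y x n.
Proof. by move=> h i lin; rewrite h. Qed.

Lemma agree_trans y x z n : agree x y n -> agree y z n -> agree x z n.
Proof. by move=> h1 h2 i lin; rewrite h1 ?h2. Qed.

Lemma agree_sub k m x y n :
  k + m <= n -> agree x y n -> agree (x + k) (y + k) m.
Proof. by move=> le h i lim; rewrite -!addnA h //; lia. Qed.

Lemma agree_take m x y n : m <= n -> agree x y n -> agree x y m.
Proof. by move=> le h i lim; rewrite h //; lia. Qed.

Lemma agree_cat x y m n :
  agree x y m -> agree (x + m) (y + m) n -> agree x y (m + n).
Proof.
move=> h1 h2 i lti; case: (ltnP i m) => [/h1//|lemi].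
have := h2 (i - m); rewrite -!addnA subnKC //; apply; lia.
Qed.

Lemma agree1 x y : w x = w y -> agree x y 1.
Proof. by move=> E [|//] _; rewrite !addn0. Qed.

Lemma agree_sigma_len x y n : agree x y n -> f (x + n) + f y = f (y + n) + f x.
Proof.
elim: n => [|n IHn] h; first by rewrite !addn0 addnC.
have := IHn (agree_take (leqnSn _) h); rewrite !addnS !sigma_lenS h //; lia.
Qed.

(* All blocks begin with La, so agreement extends one letter past the images. *)
Lemma agree_sigma x y n :
  agree x y n -> agree (f x) (f y) (f (x + n) - f x).+1.
Proof.
elim: n => [|n IHn] h.
  by rewrite addn0 subnn; apply: agree1; rewrite !trib_sigma_len.
have h' := agree_take (leqnSn _) h.
have E := agree_sigma_len h'.
have lex := leq_sigma_len (leq_addr n x).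
rewrite addnS sigma_lenS.
have -> : ((f (x + n)).+1 + (w (x + n) != Lc) - f x).+1 =
  (f (x + n) - f x).+1 + (1 + (w (x + n) != Lc)) by lia.
apply: agree_cat; first exact: IHn.
have -> : f x + (f (x + n) - f x).+1 = (f (x + n)).+1 by lia.
have ley := leq_sigma_len (leq_addr n y).
have -> : f y + (f (x + n) - f x).+1 = (f (y + n)).+1 by lia.
apply: agree_cat; first by apply: agree1; rewrite !trib_sigma_lenS h.
case nc: (w (x + n) != Lc); last by [].
apply: (@agree1 _ _).
have ncy : w (y + n) != Lc by rewrite -h.
have fS z : w z != Lc -> (f z).+1 + 1 = f z.+1 by rewrite sigma_lenS => ->.
by rewrite !fS // !trib_sigma_len.
Qed.

(** Each time the agreement goes past the La that opens a block, the next letter reveals the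
    preimage, by injectivity of [next_letter]. *)
Lemma agree_sigma_inv x y n : agree (f x) (f y) n.+1 ->
  exists2 m, agree x y m & f x + n <= f (x + m).
Proof.
elim: n => [|n IHn] h; first by exists 0; rewrite ?addn0.
have [m hm] := IHn (agree_take (leqnSn _) h).
rewrite leq_eqVlt => /predU1P[E|lt]; last by exists m => //; rewrite addnS.
exists m.+1; last by rewrite !addnS sigma_lenS -E; lia.
rewrite -addn1; apply: agree_cat => //; apply: agree1.
have E' := agree_sigma_len hm.
have := h n.+1 (ltnSn _); rewrite !addnS E.
have -> : f y + n = f (y + m) by lia.
by rewrite !trib_sigma_lenS => /next_letter_inj.
Qed.

(** A factor beginning with La starts at a block boundary; any other starts at the second letter of
    a block and extends to the left by the forced La. *)
Lemma agree_desubstitute x y n : 0 < n -> agree x y n ->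
  exists X Y N, [/\ agree X Y N, f X <= x <= (f X).+1,
                    f Y + x = f X + y & x + n <= (f (X + N)).+1].
Proof.
case: n => // n _ h.
have h0 : w x = w y by have := h 0; rewrite !addn0; apply.
case: (w x =P La) => [xa|xna].
  have [[X EX] [Y EY]] := (trib_La xa, trib_La (etrans (esym h0) xa)).
  rewrite EX EY in h *; have [N hN le] := agree_sigma_inv h.
  by exists X, Y, N; split => //; lia.
have [X [EX _]] := trib_notLa xna.
have [Y [EY _]] : exists Y, y = (f Y).+1 /\ w Y != Lc.
  by apply: trib_notLa; rewrite -h0.
have h' : agree (f X) (f Y) n.+2.
  rewrite -[n.+2]add1n; apply: agree_cat.
    by apply: agree1; rewrite !trib_sigma_len.
  by rewrite !addn1 -EX -EY.
have [N hN le] := agree_sigma_inv h'.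
by exists X, Y, N; split => //; lia.
Qed.

(** * Iterated images and their overlaps *)

Local Notation F k := (iter k f).

(* [F k n] is the length of the image under [sigma^k] of the prefix of length
   [n], and [sigma^k] of any two letters, continued inside the sequence, agree
   on [overlap k] letters. *)
Fixpoint overlap (k : nat) : nat :=
  if k is k'.+1 then (f (overlap k')).+1 else 0.
Local Notation d := overlap.

Lemma leq_iter_sigma k m n : m <= n -> F k m <= F k n.
Proof. by elim: k m n => //= k IHk m n le; apply/leq_sigma_len/IHk. Qed.

Lemma ltn_iter_sigma k m n : m < n -> F k m < F k n.
Proof. by elim: k m n => //= k IHk m n le; apply/ltn_sigma_len/IHk. Qed.

Lemma iter_sigma0 k : F k 0 = 0.
Proof. by elim: k => //= k ->. Qed.

Lemma agree_iter_sigma k x y n : agree x y n ->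
  F k (x + n) + F k y = F k (y + n) + F k x /\
  agree (F k x) (F k y) (F k (x + n) - F k x).
Proof.
move=> h; elim: k => [|k [IHe IHa]] /=.
  by split; [lia | rewrite addKn].
have lex := leq_iter_sigma k (leq_addr n x).
have ley := leq_iter_sigma k (leq_addr n y).
have := agree_sigma_len IHa; have := agree_sigma IHa.
rewrite subnKC //.
have -> : F k y + (F k (x + n) - F k x) = F k (y + n) by lia.
by move=> h1 h2; split => //; apply: agree_take h1.
Qed.

Lemma agree_overlap k x y : agree (F k x) (F k y) (d k).
Proof.
suff h z : agree 0 (F k z) (d k) by apply: agree_trans (h y); apply: agree_sym.
elim: k => [|k IHk] //=; have := agree_sigma IHk.
by rewrite add0n subn0.
Qed.

Arguments agree_overlap : clear implicits.

Lemma sigma_len_overlap k x : f (F k x + d k) = F k.+1 x + f (d k).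
Proof.
have := agree_sigma_len (agree_overlap k 0 x).
by rewrite iter_sigma0 add0n sigma_len0 /=; lia.
Qed.

Lemma tE m : t m = F m 1.
Proof. by elim: m => //= m <-; rewrite /sigma_len -T_trib. Qed.

Lemma overlapS k : d k.+1 = d k + t k.
Proof.
elim: k => // k IHk.
rewrite -[LHS]/(f (d k.+1)).+1 {1}IHk addnC [t k]tE sigma_len_overlap -tE.
by rewrite addnC -addSn.
Qed.

(** This closed form of the sum of the t_i produces the halved endpoint in the theorem. *)
Lemma overlap_t k : (d k.+1).*2 + 3 = t k.+2 + t k.
Proof.
elim: k => // k IHk; rewrite overlapS t_rec; lia.
Qed.

Lemma agree_type k x y : w x = w y ->
  F k x.+1 + F k y = F k y.+1 + F k x /\
  agree (F k x) (F k y) (F k x.+1 - F k x + d k).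
Proof.
move=> /agree1/(agree_iter_sigma k)[]; rewrite !addn1 => E h.
split=> //; apply: agree_cat => //.
have lex := leq_iter_sigma k (leqnSn x).
have ley := leq_iter_sigma k (leqnSn y).
rewrite subnKC //.
have -> : F k y + (F k x.+1 - F k x) = F k y.+1 by lia.
exact: agree_overlap.
Qed.

(** * Every repetition lies in a run *)

(** A window of length p moved along a stretch of period p is only rotated, so its image keeps its
    length. *)
Lemma iter_sigma_slide k i p m : agree i (i + p) m ->
  F k (i + p) + F k (i + m) = F k (i + m + p) + F k i.
Proof.
by move=> /(agree_iter_sigma k)[]; rewrite (addnAC i p) => E _; lia.
Qed.

(* The slack [p <= n.+1] is what makes the induction work: desubstituting a
   square may give a repetition one letter short of a square. *)
Lemma run_of_repetition p i n : 0 < p -> p <= n.+1 -> agree i (i + p) n ->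
  exists k x, [/\ p + F k x = F k x.+1, F k x <= i & i + n <= F k x + d k].
Proof.
have [r] := ubnP p; elim: r p i n => // r IHr p i n ltpr p0 lepn h.
case: (posnP n) => [n0|n0]; first by exists 0, i => /=; split; lia.
have [X [Y [N [hN leX EY leN]]]] := agree_desubstitute n0 h.
have ltXY : X < Y.
  by rewrite ltnNge; apply/negP => /leq_sigma_len; lia.
pose q := Y - X; have EYq : Y = X + q by rewrite subnKC // ltnW.
rewrite {}EYq in hN EY ltXY; clearbody q.
have q0 : 0 < q by lia.
(* Otherwise the blocks of X + N and X + N + 1 would have total length at most 2, giving two
   consecutive letters c. *)
have qN : q <= N.+1.
  rewrite leqNgt; apply/negP => ltNq.
  have := leq_sigma_len (_ : X + N.+2 <= X + q); rewrite leq_add2l => /(_ ltNq).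
  rewrite !addnS !sigma_lenS.
  case nc: (w (X + N) != Lc); first lia.
  have -> : w (X + N).+1 = La by apply: trib_notLaS; case: (w _) nc.
  by rewrite /=; lia.
have leqp : q <= p by have := leq_sigma_len_add X q; lia.
suff [k [x [Eq lex leE]]] :
    exists k x, [/\ q + F k x = F k x.+1, F k x <= X & X + N <= F k x + d k].
  (* Period q holds from [F k x] to X, so the windows of length q at both places have images of the
     same length p. *)
  have Nx : agree (F k x) (F k x + q) (X - F k x).
    by rewrite addnC Eq; apply: agree_take (agree_overlap k x x.+1); lia.
  have := iter_sigma_slide 1 Nx; rewrite /= subnKC // [F k x + q]addnC Eq => Ef.
  exists k.+1, x; split=> /=; [lia| |].
    by have := leq_sigma_len lex; lia.
  have := leq_sigma_len leE; rewrite sigma_len_overlap /=; lia.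
have [ltqp|lepq] := ltnP q p; first by apply: IHr => //; lia.
have Eqp : q = p by lia.
(* Desubstitution fails to shorten the period only over a single c; there N = 0 and a run of level 0
   suffices. *)
have [q1 Xc] : q = 1 /\ w X = Lc by apply: sigma_len_period => //; lia.
have N0 : N = 0.
  case: N hN {leN qN} => // N /(_ 0 isT); rewrite q1 addn0 addn1 Xc addn0.
  by rewrite trib_notLaS // Xc.
by exists 0, X; rewrite q1 N0 /=; split; lia.
Qed.

(** * Image lengths of letters and short prefixes *)

Definition first_index (x : letter) : nat :=
  match x with La => 0 | Lb => 1 | Lc => 3 end.

Lemma trib_first_index x : w (first_index x) = x.
Proof. by case: x. Qed.

Lemma first_index_leq n : first_index (w n) <= n.
Proof. by case: n => [|[|[|n]]] //; case: (w _). Qed.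

(** The prefixes ab, aba and abac are sigma(a), sigma(a)a and sigma^2(a). *)
Lemma iter_sigma2 k : F k 2 = t k.+1.
Proof. by rewrite tE iterSr. Qed.

Lemma iter_sigma3 k : F k 3 = t k.+1 + t k.
Proof.
have [] := @agree_type k 2 0 erefl; rewrite iter_sigma0 iter_sigma2 -tE; lia.
Qed.

Lemma iter_sigma4 k : F k 4 = t k.+2.
Proof. by rewrite -iter_sigma2 iterSr. Qed.

Lemma ltn_t m n : m < n -> t m < t n.
Proof.
suff tS k : t k < t k.+1.
  elim: n => // n IHn; rewrite ltnS leq_eqVlt => /predU1P[->//|/IHn h].
  exact: ltn_trans h (tS n).
by rewrite -iter_sigma2 tE ltn_iter_sigma.
Qed.

Lemma leq_t m n : m <= n -> t m <= t n.
Proof. by rewrite leq_eqVlt => /predU1P[->//|/ltn_t/ltnW]. Qed.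

Lemma t_inj : injective t.
Proof. by move=> m n; case: (ltngtP m n) => // /ltn_t; lia. Qed.

(** * Image lengths of factors and primitivity of run periods *)

Definition factor_len (k i n : nat) : nat := F k (i + n) - F k i.

Lemma factor_len_cat k i m n :
  factor_len k i (m + n) = factor_len k i m + factor_len k (i + m) n.
Proof.
have := leq_iter_sigma k (leq_addr m i).
have := leq_iter_sigma k (leq_addr n (i + m)).
by rewrite /factor_len addnA; lia.
Qed.

Lemma agree_factor_len k x y n :
  agree x y n -> factor_len k x n = factor_len k y n.
Proof.
have := leq_iter_sigma k (leq_addr n x).
have := leq_iter_sigma k (leq_addr n y).
by move=> ? ? /(agree_iter_sigma k)[E _]; rewrite /factor_len; lia.
Qed.

Lemma factor_len_slide k i p m :
  agree i (i + p) m -> factor_len k (i + m) p = factor_len k i p.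
Proof. by move=> /(iter_sigma_slide k); rewrite /factor_len; lia. Qed.

Lemma letter_len k x : factor_len k x 1 =
  match w x with
  | La => t k
  | Lb => t k.+1 - t k
  | Lc => t k.+2 - (t k.+1 + t k)
  end.
Proof.
rewrite (@agree_factor_len k x (first_index (w x))); last first.
  by apply: agree1; rewrite trib_first_index.
rewrite /factor_len addn1; case: (w x) => /=.
- by rewrite iter_sigma0 subn0 -tE.
- by rewrite iter_sigma2 -tE.
- by rewrite iter_sigma4 iter_sigma3.
Qed.

Lemma letter_len_rec k x : factor_len k.+3 x 1 =
  factor_len k.+2 x 1 + factor_len k.+1 x 1 + factor_len k x 1.
Proof.
have r0 := t_rec k; have r1 := t_rec k.+1; have r2 := t_rec k.+2.
have h : F k 3 < F k 4 := ltn_iter_sigma k (ltnSn 3).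
have h' : t k < t k.+1 by apply: ltn_t.
rewrite iter_sigma3 iter_sigma4 in h.
by rewrite !letter_len; case: (w x); lia.
Qed.

(** The hypotheses say that the factors u, v of lengths m, n at i commute. They are then powers of
    one word, so image lengths are proportional to lengths; the induction is Euclid's algorithm on
    (m, n). *)
Lemma fine_wilf_factor_len k i m n : agree i (i + m) n -> agree i (i + n) m ->
  n * factor_len k i m = m * factor_len k i n.
Proof.
have [r] := ubnP (m + n); elim: r m n => // r IHr.
suff main m n : m <= n -> m + n <= r ->
    agree i (i + m) n -> agree i (i + n) m ->
    n * factor_len k i m = m * factor_len k i n.
  move=> m n ltr hm hn; case: (leqP m n) => [le|/ltnW le]; first exact: main.
  by apply/esym/main => //; rewrite addnC.
case: (posnP m) => [->|m0] lemn ler hm hn.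
  by rewrite mul0n /factor_len addn0 subnn muln0.
have En : n = m + (n - m) by lia.
set n' := n - m in En; rewrite {}En in lemn ler hm hn *.
rewrite factor_len_cat mulnDl mulnDr; congr addn.
have hm' : agree i (i + m) n' by apply: agree_take hm; lia.
rewrite -(agree_factor_len k hm'); apply: IHr => //; first lia.
apply: agree_trans hn _; rewrite addnA; apply: agree_sym.
by apply: agree_sub hm; lia.
Qed.

(* The recurrence brings divisibility from all levels above k down to level 0,
   where every letter has length 1. *)
Lemma dvdn_letter_len p s x k :
  (forall j, p %| s * factor_len (j + k) x 1) -> p %| s.
Proof.
elim: k => [|k IHk] h.
  by have := h 0; rewrite /factor_len /= addKn muln1.
apply: IHk => -[|j]; last by rewrite addSnnS.
move: (h 0) (h 1) (h 2); rewrite !(addSn, add0n).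
rewrite (letter_len_rec k) !mulnDr => h0 h1.
by rewrite dvdn_addr // dvdn_addr.
Qed.

(* A commuting rotation by s persists under all further iterates of sigma, so p
   divides s times the lengths of the images of w x at every higher level. *)
Lemma run_period_primitive k x i p s :
  p + F k x = F k x.+1 -> F k x <= i <= F k x + d k ->
  agree i (i + s) p -> agree i (i + p) s -> p %| s.
Proof.
move=> Ep /andP[lei lei'] hs hp; apply: (@dvdn_letter_len p s x k) => j.
have -> : factor_len (j + k) x 1 = factor_len j i p.
  (* The run has period p up to i, so the window at i is a rotation of sigma^k of [w x]. *)
  have h : agree (F k x) (F k x + p) (i - F k x).
    by rewrite addnC Ep; apply: agree_take (agree_overlap k x x.+1); lia.
  have := factor_len_slide j h; rewrite subnKC // => ->.
  by rewrite /factor_len !iterD addn1 -Ep addnC.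
by rewrite -(fine_wilf_factor_len j hs hp) dvdn_mulr.
Qed.

(** * Squares inside a run *)

Lemma square_of_overlap k x o p n :
  p + F k x = F k x.+1 -> o + n <= d k -> agree (F k x + o) (F k x + o + p) n.
Proof.
move=> E le; have := agree_sub le (agree_overlap k x x.+1).
by rewrite -E (_ : _ + F k x + o = F k x + o + p) //; lia.
Qed.

Lemma square_of_type k x y o p : w x = w y ->
  p + F k x = F k x.+1 -> o + p <= d k -> agree (F k x + o) (F k y + o) (p + p).
Proof.
move=> E Ep le; have [_ h] := agree_type k E; apply: agree_sub h; lia.
Qed.

(** Equal squares at these offsets would give a commuting rotation by o - o', and p would divide a
    positive number smaller than p. *)
Lemma run_square_inj k x o o' p : p + F k x = F k x.+1 -> o + p <= d k ->
  o' < o < o' + p -> ~ agree (F k x + o') (F k x + o) (p + p).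
Proof.
move=> E le /andP[lto lto'] h.
have lto'' : 0 < o - o' < p by lia.
suff : p %| o - o' by move=> /(dvdn_leq _); lia.
have Eo : F k x + o = F k x + o' + (o - o') by lia.
apply: (run_period_primitive E (i := F k x + o')); first lia.
  by rewrite -Eo; apply: agree_take h; lia.
by apply: square_of_overlap E _; lia.
Qed.

Lemma leq_tS k : t k.+1 <= (t k).*2.
Proof.
case: k => [|[|k]] //; rewrite t_rec.
have := ltn_iter_sigma k (ltnSn 3); rewrite iter_sigma3 iter_sigma4; lia.
Qed.

Lemma ltn_t2 k : t k.+1 + t k < t k.+2.
Proof. by rewrite -iter_sigma3 -iter_sigma4 ltn_iter_sigma. Qed.

Lemma leq_t_overlap k : t k <= (d k).+1.
Proof.
case: k => // k; have := overlap_t k.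
by have := leq_tS k; have := ltn_t2 k; lia.
Qed.

Lemma ltn_overlap k : d k < t k.+1.
Proof.
case: k => // k; have := overlap_t k; have := ltn_t (ltnSn k.+1).
have := ltn_t (ltnSn k); lia.
Qed.

(** The bound by [d k] rules out level 0, and at level 1 leaves only c. Over c, sigma(c) = a lowers
    the index by one. *)
Lemma run_period k x p : p + F k x = F k x.+1 -> 0 < p <= d k ->
  match w x with
  | La => exists2 j, k = j.+2 & p = t j.+2
  | Lb => exists2 j, k = j.+2 & p = t j.+3 - t j.+2
  | Lc => exists2 j, k = j.+1 & p = t j
  end.
Proof.
move=> E /andP[p0 lep]; have := letter_len k x.
rewrite /factor_len addn1 -E addnK.
case: k lep {E} => [|[|k]] lep; first by have := leq_trans p0 lep.
  by case: (w x) => Ep; [rewrite Ep in lep | rewrite Ep in lep | exists 0].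
case: (w x) => Ep; [by exists k | by exists k | exists k.+1 => //].
by rewrite Ep t_rec; lia.
Qed.

(** The difference is [t k.+1 + t k], strictly between [t k.+1] and [t k.+2]; hence periods over b
    never occur over a or c. *)
Lemma t_diff_neq j k : t j <> t k.+3 - t k.+2.
Proof.
move=> E; have := t_rec k; have := ltn_t2 k; have := t_gt k.
case: (leqP j k.+1) => /leq_t; lia.
Qed.

Lemma t_diff_inj j k : t j.+3 - t j.+2 = t k.+3 - t k.+2 -> j = k.
Proof.
rewrite !t_rec -!addnA !addKn.
have h m n : m < n -> t m.+1 + t m < t n.+1 + t n.
  by move=> lt; rewrite -addnS leq_add //; [apply: leq_t; lia | apply: ltn_t].
by case: (ltngtP j k) => // /h; lia.
Qed.

(** * First occurrences of squares *)

(** Such a square enters the prefixes at length i + 2p, the quantity tracked below. *)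
Definition first_square (i p : nat) : Prop :=
  [/\ 0 < p, agree i (i + p) p & forall i', i' < i -> ~ agree i' i (p + p)].

(* The three cases are the runs over the first La, Lb and Lc, at levels k.+2,
   k.+2 and k.+1. *)
Definition first_square_spec (i p k : nat) : Prop :=
  [\/ p = t k.+2 /\ i + p <= d k.+2,
      p = t k.+3 - t k.+2 /\ t k.+2 <= i <= t k.+2 + d k.+2 - p
    | p = t k /\ t k.+2 + t k.+1 + (d k).+1 - p <= i < t k.+2 + t k.+1 + p].

Lemma first_square_necessary i p :
  first_square i p -> exists k, first_square_spec i p k.
Proof.
move=> [p0 sq new].
have [k [x [E lex lei]]] := run_of_repetition p0 (leqnSn p) sq.
set y := first_index (w x).
have wy : w x = w y by rewrite trib_first_index.
have ley : F k y <= F k x by apply/leq_iter_sigma/first_index_leq.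
set o := i - F k x; have leo : o + p <= d k by lia.
(* The run over the first such letter has the same square at the same offset, so a first occurrence
   must lie there. *)
have Ei : i = F k y + o.
  case: (ltngtP i (F k y + o)) => // lti; first lia.
  case: (new _ lti); have := square_of_type (esym wy) _ leo.
  have [Ey _] := agree_type k wy.
  have -> : F k x + o = i by lia.
  apply; have := leq_iter_sigma k (leqnSn y); lia.
have pd : 0 < p <= d k by lia.
have := run_period E pd; rewrite {}/y in wy ley Ei.
case wx: (w x) wy ley Ei => /= _ _ Ei [j ? Ep]; subst k.
- by exists j; constructor 1; rewrite Ei iter_sigma0; split=> //; lia.
- rewrite -[iter j.+2 _ _]tE in Ei.
  by exists j; constructor 2; split=> //; lia.
rewrite iter_sigma3 in Ei; exists j; constructor 3; split=> //.
(* At offset p or more, the square would recur one period earlier. *)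
have lt_o : o < p.
  rewrite ltnNge; apply/negP => lepo.
  case: (new (i - p)); first lia.
  have := square_of_overlap (o := o - p) (n := p + p) E.
  have -> : F j.+1 x + (o - p) = i - p by lia.
  have -> : i - p + p = i by lia.
  by apply; lia.
(* As sigma(c) = a, the run starts at [F j.+1 3 = F j 6], where a run of level j over a also starts;
   a square inside the latter already occurs at o. *)
have lt_d : d j < o + p.
  rewrite ltnNge; apply/negP => lepd.
  case: (new o); first by have := t_gt j.+2; lia.
  have := @square_of_type j 0 6 o p erefl.
  rewrite iter_sigma0 -tE -Ep => /(_ (addn0 _) lepd).
  have -> : F j 6 = F j.+1 3 by rewrite iterSr.
  by rewrite iter_sigma3 -Ei.
lia.
Qed.

(** An earlier occurrence would reappear at a smaller offset of the same run, against
    [run_square_inj]. *)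
Lemma first_square_run k x o p :
    p + F k x = F k x.+1 -> 0 < p -> o + p <= d k -> o < p ->
    (forall i', i' < F k x + o -> agree i' (i' + p) p ->
       exists2 o', o' < o & agree (F k x + o') i' (p + p)) ->
  first_square (F k x + o) p.
Proof.
move=> E p0 le lto earlier; have sq := square_of_overlap E le.
split=> // i' lti h.
have [|o' lto' h'] := earlier i' lti.
  have le1 : p <= p + p by apply: leq_addr.
  apply: agree_trans (agree_take le1 h) _; apply: agree_trans sq _.
  exact/agree_sym/(agree_sub (leqnn _) h).
by apply: (run_square_inj E le _) (agree_trans h' h); lia.
Qed.

(** An earlier occurrence lies in some run; p determines its level and letter up to sigma(c) = a,
    and [square_of_type] moves it into the run considered. *)
Lemma first_square_sufficient i p k :
  first_square_spec i p k -> first_square i p.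
Proof.
have tpos m : 0 < t m by apply: leq_ltn_trans (t_gt m).
have t2 := ltn_t2 k; have t3 := t_rec k.
have dt := ltn_overlap k; have td := leq_t_overlap k.
have dS := overlapS k; have dSS := overlapS k.+1; have dt2 := overlap_t k.+1.
have tp0 := tpos k; have tp1 := tpos k.+1.
case=> [[Ep le]|[Ep le]|[Ep le]].
- have E : p + F k.+2 0 = F k.+2 1 by rewrite iter_sigma0 -tE addn0.
  have -> : i = F k.+2 0 + i by rewrite iter_sigma0.
  apply: first_square_run => //; try lia.
  by rewrite iter_sigma0 => i' lti _; exists i'.
- have E : p + F k.+2 1 = F k.+2 2 by rewrite iter_sigma2 -tE; lia.
  have -> : i = F k.+2 1 + (i - t k.+2) by rewrite -tE; lia.
  apply: first_square_run => //; try lia.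
  rewrite -tE subnKC; last lia.
  move=> i' lti sq'; have p0 : 0 < p by lia.
  have [k' [y [E' ley lei]]] := run_of_repetition p0 (leqnSn p) sq'.
  have pd : 0 < p <= d k' by lia.
  have := run_period E' pd; case wy: (w y) => -[j ? Ep']; subst k'.
  + by case: (@t_diff_neq j.+2 k); rewrite -Ep'.
  + have jk : j = k by apply: t_diff_inj; rewrite -Ep'.
    subst j; have y0 : 0 < y by case: y wy {E' ley lei}.
    have := leq_iter_sigma k.+2 y0; rewrite -tE => ley'.
    exists (i' - F k.+2 y); first lia.
    have := @square_of_type k.+2 1 y (i' - F k.+2 y) p (esym wy) E.
    by rewrite -tE subnKC //; apply; lia.
  + by case: (@t_diff_neq j k); rewrite -Ep'.
have E : p + F k.+1 3 = F k.+1 4 by rewrite iter_sigma3 iter_sigma4; lia.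
have E6 : F k 6 = F k.+1 3 by rewrite iterSr.
have E7 : F k 7 = F k.+1 4 by rewrite iterSr.
have -> : i = F k.+1 3 + (i - F k.+1 3) by rewrite iter_sigma3; lia.
apply: first_square_run => //; rewrite ?iter_sigma3; try lia.
rewrite subnKC; last lia.
move=> i' lti sq'; have p0 : 0 < p by lia.
have [k' [y [E' ley lei]]] := run_of_repetition p0 (leqnSn p) sq'.
have pd : 0 < p <= d k' by lia.
have := run_period E' pd; case wy: (w y) => -[j ? Ep']; subst k'.
(* A run over a with this period is copied to letter 6, where the run over c starts; its offsets are
   smaller because o + p exceeds [d k]. *)
+ have jk : j.+2 = k by apply: t_inj; rewrite -Ep'.
  rewrite jk in E' ley lei; exists (i' - F k y); first lia.
  have := @square_of_type k 6 y (i' - F k y) p (esym wy).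
  rewrite E6 iter_sigma3 subnKC //; apply; last lia.
  by rewrite E7 iter_sigma4; lia.
+ by case: (@t_diff_neq k j); rewrite -Ep'.
+ have jk : j = k by apply: t_inj; rewrite -Ep'.
  subst j; have y0 : 3 <= y by case: y wy {E' ley lei} => [|[|[]]].
  have := leq_iter_sigma k.+1 y0; rewrite iter_sigma3 => ley'.
  exists (i' - F k.+1 y); first lia.
  have := @square_of_type k.+1 3 y (i' - F k.+1 y) p (esym wy) E.
  by rewrite iter_sigma3 subnKC //; apply; lia.
Qed.

(** * End positions of first occurrences *)

Lemma leq_t2 k : t k.+2 <= t k.+1 + (t k).*2.
Proof. by case: k => // k; rewrite t_rec; have := ltn_t (ltnSn k); lia. Qed.

(** These ranges are disjoint for different k, so the end of a square determines its level. *)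
Lemma first_square_spec_bounds i p k : first_square_spec i p k ->
  (t k.+2).*2 <= i + p.*2 < (t k.+3).*2.
Proof.
have t2 := ltn_t2 k; have t2' := leq_t2 k; have t3 := t_rec k.
have dt := ltn_overlap k.+2; have td := leq_t_overlap k.
have dS := overlapS k; have dSS := overlapS k.+1.
by case=> [[Ep le]|[Ep le]|[Ep le]]; lia.
Qed.

(** Within a level the three families end in disjoint ranges, so at most one square is new at each
    length. *)
Lemma first_square_spec_inj i p k i' p' k' :
  first_square_spec i p k -> first_square_spec i' p' k' ->
  i + p.*2 = i' + p'.*2 -> i = i' /\ p = p'.
Proof.
move=> h h' E.
have b := first_square_spec_bounds h; have b' := first_square_spec_bounds h'.
have kk : k = k'.
  case: (ltngtP k k') => // lt.
    by have := @leq_t k.+3 k'.+2 lt; lia.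
  by have := @leq_t k'.+3 k.+2 lt; lia.
subst k'; have dt := ltn_overlap k; have t01 := ltn_t (ltnSn k).
have t2 := ltn_t2 k; have t2' := leq_t2 k; have t3 := t_rec k.
have td := leq_t_overlap k.
have dS := overlapS k; have dSS := overlapS k.+1.
by case: h h' => [[Ep le]|[Ep le]|[Ep le]] [[Ep' le']|[Ep' le']|[Ep' le']]; lia.
Qed.

(** Put m = k + 3. Ends over a and over c meet after [t k.+2 + d k.+2] and fill the first interval;
    ends over b fill the second. *)
Lemma in_unionP n :
  (exists2 m : nat, 3 <= m &
      (2 * t (m - 1) <= n <= t m + 2 * t (m - 3) - 1)
      \/ (2 * t m - t (m - 1) <= n <= (3 * t m + t (m - 2) - 3) %/ 2)) <->
  exists i p, first_square i p /\ i + p.*2 = n.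
Proof.
split=> [[m m3]|[i [p [/first_square_necessary[k spec] <-]]]].
  have -> : m = (m - 3).+3 by lia.
  move: (m - 3) => k; rewrite !subSS !subn0 => {m m3} h.
  suff [i [p [spec E]]] : exists i p, first_square_spec i p k /\ i + p.*2 = n.
    by exists i, p; split=> //; apply: first_square_sufficient spec.
  have t2 := ltn_t2 k; have t2' := leq_t2 k; have t3 := t_rec k.
  have td := leq_t_overlap k; have dS := overlapS k.
  have dSS := overlapS k.+1; have dt2 := overlap_t k.+1.
  case: h => h.
    case: (leqP n (t k.+2 + d k.+2)) => len.
      exists (n - (t k.+2).*2), (t k.+2); split; last lia.
      by constructor 1; lia.
    exists (n - (t k).*2), (t k); split; last lia.
    by constructor 3; lia.
  exists (n - (t k.+3 - t k.+2).*2), (t k.+3 - t k.+2); split; last lia.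
  by constructor 2; lia.
exists k.+3 => //; rewrite !subSS !subn0.
have dt := ltn_overlap k; have tS := leq_tS k.
have t2 := ltn_t2 k; have t2' := leq_t2 k; have t3 := t_rec k.
have td := leq_t_overlap k; have dS := overlapS k.
have dSS := overlapS k.+1; have dt2 := overlap_t k.+1.
by case: spec => [[Ep le]|[Ep le]|[Ep le]]; [left|right|left]; lia.
Qed.

(** * From positions back to words *)

Definition factor (i m : nat) : seq letter := mkseq (fun x => w (i + x)) m.

Lemma size_factor i m : size (factor i m) = m.
Proof. exact: size_mkseq. Qed.

Lemma factor_agreeP i j m : factor i m = factor j m <-> agree i j m.
Proof.
split=> [E x ltx|h].
  by have := congr1 (nth La ^~ x) E; rewrite !nth_mkseq.
apply: (@eq_from_nth _ La); rewrite !size_factor // => x ltx.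
by rewrite !nth_mkseq // h.
Qed.

Lemma factor_cat i m n : factor i (m + n) = factor i m ++ factor (i + m) n.
Proof.
rewrite /factor /mkseq iotaD map_cat; congr cat.
rewrite add0n -[m in iota m]addn0 iotaDl -map_comp.
by apply: eq_map => x /=; rewrite addnA.
Qed.

Lemma infix_trib_prefixP u n :
  infix u (trib_prefix n) <->
  exists2 i, i + size u <= n & u = factor i (size u).
Proof.
rewrite -[trib_prefix n]/(factor 0 n); split=> [/infixP[v [v' E]]|[i lei ->]].
  have En := congr1 size E; rewrite !size_cat size_factor in En.
  exists (size v); first lia.
  move: E; rewrite En !factor_cat => /eqP.
  rewrite eqseq_cat ?size_factor // => /andP[_].
  by rewrite eqseq_cat ?size_factor // => /andP[/eqP].
have -> : n = i + (size u + (n - (i + size u))) by lia.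
by rewrite !factor_cat infix_catl // prefix_infix ?prefix_prefix.
Qed.

Lemma infix_squareP u n : infix (u ++ u) (trib_prefix n) <->
  exists i, [/\ i + (size u).*2 <= n, u = factor i (size u)
              & agree i (i + size u) (size u)].
Proof.
rewrite infix_trib_prefixP size_cat addnn -addnn.
split=> [[i lei]|[i [lei E /factor_agreeP E']]]; last first.
  by exists i; rewrite -?addnn // factor_cat -E' -E.
rewrite factor_cat => /eqP; rewrite eqseq_cat ?size_factor //.
move=> /andP[/eqP E /eqP E'].
by exists i; split=> //; apply/factor_agreeP; rewrite -E -E'.
Qed.

(** Any occurrence of a new square must end at the last letter of the longer prefix. *)
Lemma new_squareP u n :
  [/\ u <> [::], infix (u ++ u) (trib_prefix n.+1)
    & ~~ infix (u ++ u) (trib_prefix n)] <->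
  exists i p, [/\ first_square i p, i + p.*2 = n.+1 & u = factor i p].
Proof.
split=> [[u0 /infix_squareP[i [lei Eu sq]] /negP new]|].
  exists i, (size u); split=> //; last first.
    apply/eqP; rewrite eqn_leq lei ltnNge; apply/negP => le.
    by case: new; apply/infix_squareP; exists i.
  split=> // [|i' lti h]; first by case: (u) u0.
  case: new; apply/infix_squareP; exists i'; split; first lia.
    rewrite {1}Eu; apply/factor_agreeP/agree_sym; apply: agree_take h.
    exact: leq_addr.
  have le1 : size u <= size u + size u by apply: leq_addr.
  apply: agree_trans (agree_take le1 h) _; apply: agree_trans sq _.
  exact/agree_sym/(agree_sub (leqnn _) h).
move=> [i [p [[p0 sq new] En ->]]]; split; first by case: (p) p0.
  by apply/infix_squareP; exists i; rewrite size_factor En.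
apply/negP => /infix_squareP[i' []]; rewrite size_factor => lei Ei sq'.
apply: (new i'); first lia.
move/factor_agreeP: Ei => h; apply: agree_cat; first exact: agree_sym.
by apply: agree_trans (agree_sym sq') _; apply: agree_trans (agree_sym h) _.
Qed.

(** * Counting the new squares *)

Definition new_squares (n : nat) : {set n.+1.-bseq letter} :=
  [set u : n.+1.-bseq letter |
     [&& (u : seq letter) != [::], infix (u ++ u) (trib_prefix n.+1)
       & ~~ infix (u ++ u) (trib_prefix n)]].

Lemma trib_prefix_infix u n :
  infix u (trib_prefix n) -> infix u (trib_prefix n.+1).
Proof.
move=> /infix_trib_prefixP[i lei E]; apply/infix_trib_prefixP.
by exists i => //; lia.
Qed.

Lemma card_new_squares n : A n.+1 = A n + #|new_squares n|.
Proof.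
pose B := [set u : n.+1.-bseq letter | infix (u ++ u) (trib_prefix n)].
rewrite /A -(cardsID B); congr addn; last first.
  by apply: eq_card => u; rewrite !inE andbC -andbA.
(* Roots for [A n] live in a smaller type of bounded words; [h] embeds them, and [size_square_root]
   shows that it reaches every old root. *)
pose h (u : n.-bseq letter) : n.+1.-bseq letter :=
  @Bseq n.+1 letter u (leqW (size_bseq u)).
have h_inj : injective h by move=> u v /(congr1 val) E; apply/val_inj.
rewrite -(card_imset _ h_inj); apply: eq_card => u; rewrite !inE.
apply/idP/imsetP => [/andP[/andP[u0 _] uu]|[v]].
  exists (Bseq (size_square_root uu)); last exact/val_inj.
  by rewrite inE u0.
by rewrite inE => /andP[v0 vv] ->; rewrite v0 vv trib_prefix_infix.
Qed.

Theorem propositiona (n : nat) (n_gt0 : 0 < n) :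
  let in_union :=
    exists2 m : nat, 3 <= m &
      (2 * t (m - 1) <= n <= t m + 2 * t (m - 3) - 1)
      \/ (2 * t m - t (m - 1) <= n <= (3 * t m + t (m - 2) - 3) %/ 2)
  in
  (in_union -> a n = 1%R) /\ (~ in_union -> a n = 0%R).
Proof.
move=> in_union; rewrite /a; case: n n_gt0 @in_union => // n _ in_union.
rewrite /= card_new_squares PoszD GRing.addrC GRing.addKr.
have inN (u : n.+1.-bseq letter) : u \in new_squares n <->
    exists i p, [/\ first_square i p, i + p.*2 = n.+1
                  & u = factor i p :> seq letter].
  rewrite inE -new_squareP; split=> [/and3P[/eqP]|[/eqP u0 uu nuu]] //.
  exact/and3P.
split=> [/in_unionP[i [p [new En]]]|not_in].
  suff -> : #|new_squares n| = 1 by [].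
  have le : size (factor i p) <= n.+1 by rewrite size_factor; lia.
  apply/eqP/cards1P; exists (Bseq le); apply/setP => u; rewrite [RHS]inE.
  apply/idP/eqP => [/inN[i' [p' [new' En' Eu]]]|->]; last first.
    by apply/inN; exists i, p.
  apply/val_inj; rewrite /= Eu.
  have [k spec] := first_square_necessary new.
  have [k' spec'] := first_square_necessary new'.
  by have [-> ->] := first_square_spec_inj spec spec' (etrans En (esym En')).
suff -> : new_squares n = set0 by rewrite cards0.
apply/setP => u; rewrite [RHS]inE; apply/negP => /inN[i [p [new En _]]].
by apply: not_in; apply/in_unionP; exists i, p.
Qed.
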